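(* Let $\alpha,\beta,x,y$, $\mathbf a=(a_n)_{n\ge0}$, $\mathbf b=(b_n)_{n\ge1}$, $\mathbf c=(c_n)_{n\ge1}$, $\mathbf d=(d_n)_{n\ge0}$, $\mathbf e=(e_n)_{n\ge0}$, $\mathbf f=(f_n)_{n\ge0}$ be indeterminates. Let $L$ be the lower-bidiagonal matrix with $a_0,a_1,\dots$ on the diagonal and $b_1,b_2,\dots$ on the subdiagonal; $U$ the upper-bidiagonal matrix with $d_0,d_1,\dots$ on the diagonal and $c_1,c_2,\dots$ on the superdiagonal; $D_1=\mathrm{diag}(e_0,e_1,\dots)$, $D_2=\mathrm{diag}(f_0,f_1,\dots)$; $L_1=\alpha I+xL$ and $L_2=\beta I+yL$ (all matrices indexed by $\mathbb N\times\mathbb N$). Then the matrix $$P=L_1L_2U+L_1D_1+L_2D_2$$ is totally positive, coefficientwise in the indeterminates $\alpha,\beta,x,y,\mathbf a,\mathbf b,\mathbf c,\mathbf d,\mathbf e,\mathbf f$.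
   Context: Coefficientwise total positivity: every minor is a polynomial with nonnegative coefficients in the indicated indeterminates. *)

(* Defs.v *)
From HB Require Import structures.
From mathcomp Require Import all_boot all_algebra.
From mathcomp Require Import finmap monalg.
From mathcomp Require Import classical_sets fsbigop.

Set Implicit Arguments.
Unset Strict Implicit.
Unset Printing Implicit Defensive.

Local Open Scope ring_scope.

(* The sequences b and c start at index 1: [vb n] and [vc n] name the
   indeterminates b_{n+1} and c_{n+1}. *)
Inductive var :=
  | valpha | vbeta | vx | vy
  | va of nat | vb of nat | vc of nat | vd of nat | ve of nat | vf of nat.

Definition var_code (v : var) : nat * nat :=
  match v with
  | valpha => (0, 0) | vbeta => (1, 0) | vx => (2, 0) | vy => (3, 0)
  | va n => (4, n) | vb n => (5, n) | vc n => (6, n)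
  | vd n => (7, n) | ve n => (8, n) | vf n => (9, n)
  end%N.

Definition var_decode (c : nat * nat) : var :=
  match c.1 with
  | 0 => valpha | 1 => vbeta | 2 => vx | 3 => vy
  | 4 => va c.2 | 5 => vb c.2 | 6 => vc c.2
  | 7 => vd c.2 | 8 => ve c.2 | _ => vf c.2
  end%N.

Lemma var_codeK : cancel var_code var_decode.
Proof. by case. Qed.

HB.instance Definition _ := Choice.copy var (can_type var_codeK).

(* Polynomials in the infinitely many indeterminates [var] are the monoid
   algebra over the free commutative monoid [{cmonom var}]. *)
Notation polyvar R := {malg R[{cmonom var}]}.

Definition indet (R : numDomainType) (v : var) : polyvar R :=
  mkmalgU (ucm v) 1.

Definition coef_ge0 (R : numDomainType) (p : polyvar R) : Prop :=
  forall m : {cmonom var}, 0 <= mcoeff m p.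

Definition infmx (A : Type) := nat -> nat -> A.

Section InfiniteMatrices.
Variable A : comNzRingType.
Implicit Types M N : infmx A.

Definition infmx_diag (e : nat -> A) : infmx A :=
  fun i j => if i == j then e i else 0.

Definition infmx_id : infmx A := infmx_diag (fun=> 1).

(* [b n] is the entry in position (n+1, n). *)
Definition lower_bidiag (a b : nat -> A) : infmx A :=
  fun i j => if i == j then a i else if i == j.+1 then b j else 0.

(* [c n] is the entry in position (n, n+1). *)
Definition upper_bidiag (d c : nat -> A) : infmx A :=
  fun i j => if i == j then d i else if j == i.+1 then c i else 0.

Definition infmx_add M N : infmx A := fun i j => M i j + N i j.

Definition infmx_scale (z : A) M : infmx A := fun i j => z * M i j.

(* The sum over all k in nat has finite support as soon as M has finitely
   many nonzero entries in each row, e.g. when M is banded; fsbigop gives the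
   junk value 0 to sums with infinite support. *)
Definition infmx_mul M N : infmx A :=
  fun i j => \sum_(k \in [set: nat]%classic) (M i k * N k j).

Definition minor M n (r c : 'I_n -> nat) : A :=
  \det (\matrix_(i < n, j < n) M (r i) (c j)).

End InfiniteMatrices.

Definition coef_totally_positive (R : numDomainType) (M : infmx (polyvar R)) :
    Prop :=
  forall (n : nat) (r c : 'I_n -> nat),
    (forall i j : 'I_n, (i < j)%N -> (r i < r j)%N) ->
    (forall i j : 'I_n, (i < j)%N -> (c i < c j)%N) ->
    coef_ge0 (minor M r c).

Declare Scope infmx_scope.
Delimit Scope infmx_scope with IM.
Notation "M + N" := (infmx_add M N) : infmx_scope.
Notation "M * N" := (infmx_mul M N) : infmx_scope.
Notation "z *: M" := (infmx_scale z M) : infmx_scope.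

(* Main.v *)
Require Import Defs.
From HB Require Import structures.
From mathcomp Require Import all_boot all_order all_algebra.
From mathcomp Require Import finmap monalg.
From mathcomp Require Import perm zify ring.
From mathcomp Require Import classical_sets fsbigop.

Set Implicit Arguments.
Unset Strict Implicit.
Unset Printing Implicit Defensive.

Import Order.TTheory GRing.Theory Num.Theory.
Local Open Scope ring_scope.

(** Column j of P is a combination, with indeterminates as weights, of the
    columns j of L_1, j of L_2, j of L_1 L_2 and j - 1 of L_1 L_2, so by
    multilinearity a minor is a positive combination of determinants whose
    columns are chosen among these four kinds.  Both L_t are affine in L, so they
    commute, and column k of L_1 L_2 is a positive combination of columns k and
    k + 1 of L_t for either t.  The difficulty is that a minor mixing columns of
    L_1 and L_2 in the wrong order has no sign: expand every column of L_1 L_2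
    over a "colour" t chosen so that two neighbouring columns which may reach
    the same index get the same colour, hence become equal there and kill the
    determinant.  Such a colouring exists unless the same column of L_1 L_2
    was chosen twice.  What survives are minors of lower-bidiagonal matrices
    whose j-th column is that of L_1 or L_2, and expanding these over unit
    vectors gives determinants equal to 0 or 1. *)

(** * Polynomials with nonnegative coefficients *)

Section CoefficientwisePositivity.
Variable R : numDomainType.
Implicit Types p q : polyvar R.

Lemma coef_ge0_nat (k : nat) : coef_ge0 (k%:R : polyvar R).
Proof. by move=> m; rewrite mcoeffMn mcoeff1 mulrn_wge0 ?ler0n. Qed.

Lemma coef_ge0D p q : coef_ge0 p -> coef_ge0 q -> coef_ge0 (p + q).
Proof. by move=> p0 q0 m; rewrite mcoeffD addr_ge0. Qed.

Lemma coef_ge0M p q : coef_ge0 p -> coef_ge0 q -> coef_ge0 (p * q).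
Proof.
move=> p0 q0 m; rewrite mcoeffMl sumr_ge0 // => k1 _.
by rewrite sumr_ge0 // => k2 _; rewrite mulrn_wge0 // mulr_ge0.
Qed.

Lemma coef_ge0_indet v : coef_ge0 (indet R v).
Proof. by move=> m; rewrite /indet mcoeffU mulrn_wge0 ?ler01. Qed.

Lemma coef_ge0_sum (I : Type) (s : seq I) (P : pred I) (F : I -> polyvar R) :
  (forall i, P i -> coef_ge0 (F i)) -> coef_ge0 (\sum_(i <- s | P i) F i).
Proof.
move=> F0; apply: big_ind => //; first exact: (coef_ge0_nat 0).
exact: coef_ge0D.
Qed.

Lemma coef_ge0_prod (I : Type) (s : seq I) (P : pred I) (F : I -> polyvar R) :
  (forall i, P i -> coef_ge0 (F i)) -> coef_ge0 (\prod_(i <- s | P i) F i).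
Proof.
move=> F0; apply: big_ind => //; first exact: (coef_ge0_nat 1).
exact: coef_ge0M.
Qed.

End CoefficientwisePositivity.

(** * Multilinearity of the determinant in its columns *)

Section ColumnDeterminants.
Variables (A : comNzRingType) (n : nat).
Implicit Types (r : 'I_n -> nat) (v : 'I_n -> nat -> A).

Definition coldet r v : A := \det (\matrix_(i < n, j < n) v j (r i)).

Lemma eq_coldet r v v' : (forall j i, v j i = v' j i) -> coldet r v = coldet r v'.
Proof.
by move=> vv'; congr (\det _); apply/matrixP => i j; rewrite !mxE.
Qed.

Lemma coldet_sum (K : finType) r (w : 'I_n -> K -> A)
    (u : 'I_n -> K -> nat -> A) :
  coldet r (fun j i => \sum_k w j k * u j k i) =
  \sum_(phi : {ffun 'I_n -> K})
    (\prod_j w j (phi j)) * coldet r (fun j => u j (phi j)).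
Proof.
rewrite /coldet -det_tr [LHS]/determinant.
under eq_bigr => s _.
  under eq_bigr => j _ do rewrite !mxE.
  rewrite bigA_distr_bigA mulr_sumr; over.
rewrite exchange_big; apply: eq_bigr => phi _.
rewrite -det_tr [X in _ * X]/determinant mulr_sumr; apply: eq_bigr => s _.
rewrite big_split mulrCA; congr (_ * (_ * _)).
by apply: eq_bigr => j _; rewrite !mxE.
Qed.

Lemma coldet_dup r v (i j : 'I_n) : i != j -> v i =1 v j -> coldet r v = 0.
Proof.
move=> ij vij; rewrite /coldet -det_tr.
by apply: (determinant_alternate ij) => k; rewrite !mxE vij.
Qed.

End ColumnDeterminants.

(** * Increasing maps on finite ordinals *)

Lemma ord_adjacent_homo n (f : 'I_n -> nat) :
    (forall i j : 'I_n, j = i.+1 :> nat -> (f i < f j)%N) ->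
  forall i j : 'I_n, (i < j)%N -> (f i < f j)%N.
Proof.
move=> f_adj i [j lejn] /=; elim: j lejn => // j IHj lejn ltij.
have lej : (j < n)%N := ltnW lejn.
have fj : (f (Ordinal lej) < f (Ordinal lejn))%N by exact: f_adj.
have [ltij'|leji] := ltnP i j; first exact: ltn_trans (IHj lej ltij') fj.
suff -> : i = Ordinal lej by [].
by apply/val_inj/eqP; rewrite eqn_leq leji -ltnS ltij.
Qed.

Lemma ord_homo_ge n (f : 'I_n -> 'I_n) :
    (forall i j : 'I_n, (i < j)%N -> (f i < f j)%N) ->
  forall i : 'I_n, (i <= f i)%N.
Proof.
move=> f_mono [i ltin]; elim: i ltin => // i IHi ltin /=.
apply: leq_ltn_trans (IHi (ltnW ltin)) _; exact: f_mono.
Qed.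

(** The inverse of [s] is increasing too, so [ord_homo_ge] bounds [s i] from both sides. *)
Lemma perm_homo_eq1 n (s : 'S_n) :
  (forall i j : 'I_n, (i < j)%N -> (s i < s j)%N) -> s = 1%g.
Proof.
move=> s_mono; apply/permP => i; rewrite perm1.
have sV_mono (j k : 'I_n) : (j < k)%N -> ((s^-1)%g j < (s^-1)%g k)%N.
  move=> ltjk; rewrite ltnNge; apply/negP; rewrite leq_eqVlt => /orP[/eqP|/s_mono].
    by move/val_inj/perm_inj => kj; rewrite kj ltnn in ltjk.
  by rewrite !permKV ltnNge (ltnW ltjk).
apply/val_inj/eqP; rewrite eqn_leq (ord_homo_ge s_mono) andbT.
by have := ord_homo_ge sV_mono (s i); rewrite permK.
Qed.

(** * Columns of L_1, L_2 and L_1 L_2 *)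

Section Columns.
Variable A : comNzRingType.

Definition unit_col (m i : nat) : A := (i == m)%:R.

(* [g t m s] is the entry in position (m + s, m) of the lower-bidiagonal
   matrix L_t, the booleans [true] and [false] standing for L_1 and L_2. *)
Variable g : bool -> nat -> bool -> A.

Definition bidiag_col (t : bool) (m i : nat) : A :=
  \sum_(s : bool) g t m s * unit_col (m + s) i.

Variable LL : nat -> nat -> A.
(** Column [k] of the other factor supplies the weights; having this for both [t] encodes that L_1
    and L_2 commute. *)
Hypothesis LLE : forall t k i,
  LL k i = \sum_(s : bool) g (~~ t) k s * bidiag_col t (k + s) i.

(* The four columns of which column k of P is a combination: [inl t] is column k
   of L_t, [inr true] and [inr false] are columns k and k - 1 of L_1 L_2. *)
Definition choice_col (k : nat) (X : bool + bool) : nat -> A :=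
  match X with
  | inl t => bidiag_col t k
  | inr true => LL k
  | inr false => if k is k'.+1 then LL k' else fun=> 0
  end.

(** Index of the column of L_t in term [s] of the expansion of a chosen column. At [k = 0] the
    truncated [inr false] case is harmless, its coefficient being 0. *)
Definition choice_pos (k : nat) (X : bool + bool) (s : bool) : nat :=
  match X with
  | inl _ => k
  | inr true => k + s
  | inr false => k - ~~ s
  end%N.

(** A column [inl] needs a single term, so [s%:R] kills the other one. *)
Definition choice_coef (t : bool) (k : nat) (X : bool + bool) (s : bool) : A :=
  match X with
  | inl _ => s%:R
  | inr true => g (~~ t) k s
  | inr false => if k is k'.+1 then g (~~ t) k' s else 0
  end.

Lemma choice_colE t k X i : (forall t', X = inl t' -> t = t') ->
  choice_col k X i =
  \sum_(s : bool) choice_coef t k X s * bidiag_col t (choice_pos k X s) i.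
Proof.
case: X => [t'|[]] /= tX; rewrite ?big_bool /=.
- by rewrite (tX _ erefl) mul1r mul0r addr0.
- by rewrite (LLE t) big_bool.
- case: k => [|k]; first by rewrite !mul0r addr0.
  by rewrite (LLE t) big_bool /= subn0 subn1 addn0 addn1.
Qed.

End Columns.

(** * Positive expansions into unit columns *)

Section PositiveColumns.
Variables (R : numDomainType) (n : nat).
Let A : comNzRingType := polyvar R.
Variable r : 'I_n -> nat.
Hypothesis r_mono : forall i j : 'I_n, (i < j)%N -> (r i < r j)%N.

Lemma coldet_sum_ge0 (K : finType) (w : 'I_n -> K -> A)
    (u : 'I_n -> K -> nat -> A) :
    (forall j k, coef_ge0 (w j k)) ->
    (forall phi : {ffun 'I_n -> K},
       coef_ge0 (coldet r (fun j => u j (phi j)))) ->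
  coef_ge0 (coldet r (fun j i => \sum_k w j k * u j k i)).
Proof.
move=> w0 u0; rewrite coldet_sum; apply: coef_ge0_sum => phi _.
by apply: coef_ge0M => //; apply: coef_ge0_prod.
Qed.

(** If two neighbours share an index, their columns agree and the determinant vanishes; otherwise
    the weakly increasing [m] is strictly increasing. *)
Lemma coldet_ge0_dedup (v : 'I_n -> nat -> A) (m : 'I_n -> nat) :
    (forall i j : 'I_n, j = i.+1 :> nat -> (m i <= m j)%N) ->
    (forall i j : 'I_n, j = i.+1 :> nat -> m i = m j -> v i =1 v j) ->
    ((forall i j : 'I_n, (i < j)%N -> (m i < m j)%N) -> coef_ge0 (coldet r v)) ->
  coef_ge0 (coldet r v).
Proof.
move=> m_le m_eq v0.
have [/existsP[i /existsP[j /andP[/eqP ij /eqP mij]]]|noeq] :=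
    boolP [exists i : 'I_n, exists j : 'I_n, (j == i.+1 :> nat) && (m i == m j)].
  rewrite (@coldet_dup _ _ _ _ i j); first exact: (coef_ge0_nat R 0).
    by rewrite -val_eqE /= ij neq_ltn ltnSn.
  exact: m_eq.
apply: v0; apply: ord_adjacent_homo => i j ij.
rewrite ltn_neqAle m_le // andbT; apply: contra noeq => mij.
by apply/existsP; exists i; apply/existsP; exists j; rewrite ij eqxx.
Qed.

(** Since [r] and [m] both increase, only the identity permutation can contribute to the Leibniz
    formula. *)
Lemma coldet_unit_ge0 (m : 'I_n -> nat) :
    (forall i j : 'I_n, (i < j)%N -> (m i < m j)%N) ->
  coef_ge0 (coldet r (fun j => unit_col A (m j))).
Proof.
move=> m_mono; rewrite /coldet /determinant; apply: coef_ge0_sum => s _.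
under eq_bigr => i _ do rewrite mxE /unit_col.
have [/forallP rm|] := boolP [forall i, r i == m (s i)]; last first.
  rewrite negb_forall => /existsP[i /negPf ri].
  by rewrite (bigD1 i) //= ri mul0r mulr0; exact: (coef_ge0_nat R 0).
rewrite (_ : s = 1%g).
  rewrite odd_perm1 expr0 mul1r; apply: coef_ge0_prod => i _.
  exact: coef_ge0_nat.
apply: perm_homo_eq1 => i j ltij; have := r_mono ltij.
rewrite (eqP (rm i)) (eqP (rm j)) ltnNge => /negP mij.
rewrite ltnNge leq_eqVlt; apply/negP => /orP[/eqP/val_inj/perm_inj ji|].
  by rewrite ji ltnn in ltij.
by move/m_mono/ltnW.
Qed.

Variable g : bool -> nat -> bool -> A.
Hypothesis g_ge0 : forall t m s, coef_ge0 (g t m s).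

Lemma coldet_bidiag_ge0 (t : 'I_n -> bool) (m : 'I_n -> nat) :
    (forall i j : 'I_n, (i < j)%N -> (m i < m j)%N) ->
  coef_ge0 (coldet r (fun j => bidiag_col g (t j) (m j))).
Proof.
move=> m_mono; apply: coldet_sum_ge0 => [//|s].
(* Shifting some indices by one keeps a strictly increasing sequence weakly increasing. *)
apply: (@coldet_ge0_dedup _ (fun j => (m j + s j)%N)) => [i j ij|i j _ -> //|].
  have : (m i < m j)%N by apply: m_mono; rewrite ij.
  by case: (s i); lia.
exact: coldet_unit_ge0.
Qed.

Lemma choice_coef_ge0 t k X s : coef_ge0 (choice_coef g t k X s).
Proof.
case: X => [t'|[]] /=; [exact: coef_ge0_nat|exact: g_ge0|].
by case: k => [|k]; [exact: (coef_ge0_nat R 0)|exact: g_ge0].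
Qed.

End PositiveColumns.

(* [b] is the colour wanted for the last index when it is not yet forced by
   an [inl]; it makes the induction go through. *)
Lemma colouring (X : nat -> bool + bool) (n : nat) (b : bool) :
  exists t : nat -> bool,
    [/\ forall i t', (i <= n)%N -> X i = inl t' -> t i = t',
        forall i, (i < n)%N -> X i = inr true \/ X i.+1 = inr false ->
          t i = t i.+1
      & X n = inr true -> t n = b].
Proof.
elim: n b => [|n IHn] b.
  exists (fun=> if X 0 is inl t then t else b); split => //.
    by move=> i t'; rewrite leqn0 => /eqP -> ->.
  by move=> ->.
(* [b'] is requested at [n] in case [X n = inr true] links [n] to [n.+1]; [b''] instead copies [t n]
   when [X n.+1 = inr false] forces the link. *)
pose b' := if X n.+1 is inl t then t else b.
have [t [t_inl t_adj t_last]] := IHn b'.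
pose b'' := if X n.+1 is inr false then t n else b'.
exists (fun i => if i == n.+1 then b'' else t i); split.
- move=> i t'; rewrite leq_eqVlt; have [-> _ Xi|_ /= lein] := eqVneq i n.+1.
    by rewrite /b'' /b' Xi.
  exact: t_inl.
- move=> i; rewrite ltnS leq_eqVlt eqSS => /orP[/eqP ->|ltin].
    rewrite eqxx ltn_eqF // /b''.
    case EX: (X n.+1) => [t'|[]] // [Xn|//]; exact: t_last.
  by rewrite !ltn_eqF ?ltnS //; [exact: t_adj|exact: ltnW].
- by rewrite eqxx /b'' /b' => ->.
Qed.

(** * Positivity of one choice of columns *)

Section PositiveChoices.
Variables (R : numDomainType) (n : nat).
Let A : comNzRingType := polyvar R.
Variables (r c : 'I_n -> nat) (g : bool -> nat -> bool -> A).
Variable LL : nat -> nat -> A.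
Hypothesis r_mono : forall i j : 'I_n, (i < j)%N -> (r i < r j)%N.
Hypothesis c_mono : forall i j : 'I_n, (i < j)%N -> (c i < c j)%N.
Hypothesis g_ge0 : forall t m s, coef_ge0 (g t m s).
Hypothesis LLE : forall t k i,
  LL k i = \sum_(s : bool) g (~~ t) k s * bidiag_col g t (k + s) i.

Lemma coldet_choice_ge0 (X : 'I_n -> bool + bool) :
  coef_ge0 (coldet r (fun j => choice_col g LL (c j) (X j))).
Proof.
(* Either two neighbours pick the same column of L_1 L_2 and the determinant is 0, or a colouring is
   usable. *)
have [/existsP[i /existsP[j /and4P[/eqP ij /eqP cij /eqP Xi /eqP Xj]]]|nodup] :=
  boolP [exists i : 'I_n, exists j : 'I_n,
    [&& j == i.+1 :> nat, c j == (c i).+1, X i == inr true & X j == inr false]].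
  rewrite (@coldet_dup _ _ _ _ i j); first exact: (coef_ge0_nat R 0).
    by rewrite -val_eqE /= ij neq_ltn ltnSn.
  by move=> k; rewrite /choice_col Xi Xj cij.
(* The value [inl true] outside the range is arbitrary. *)
pose Y (i : nat) := oapp X (inl true) (insub i).
have YE (i : 'I_n) : Y i = X i by rewrite /Y valK.
have [t [t_inl t_adj _]] := colouring Y n true.
have colE (j : 'I_n) i : choice_col g LL (c j) (X j) i =
    \sum_(s : bool) choice_coef g (t j) (c j) (X j) s *
      bidiag_col g (t j) (choice_pos (c j) (X j) s) i.
  apply: choice_colE => // t' Xj; apply: t_inl; last by rewrite YE.
  exact: ltnW.
rewrite (eq_coldet _ colE).
apply: coldet_sum_ge0 => [j s|s]; first exact: choice_coef_ge0.
have tadj (i j : 'I_n) : j = i.+1 :> nat ->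
    X i = inr true \/ X j = inr false -> t i = t j.
  by rewrite -!YE => ij; rewrite ij; apply: t_adj; rewrite -ij ltnW.
(* Only [inr true] moves an index up and only [inr false] moves it down, each by one. So a collision
   needs one of them, and a crossing needs both with [c j = (c i).+1], excluded by [nodup]. *)
have step (i j : 'I_n) : j = i.+1 :> nat ->
    (choice_pos (c i) (X i) (s i) <= choice_pos (c j) (X j) (s j))%N /\
    (choice_pos (c i) (X i) (s i) = choice_pos (c j) (X j) (s j) -> t i = t j).
  move=> ij; have ltc : (c i < c j)%N by apply: c_mono; rewrite ij.
  have ndup : ~ [/\ X i = inr true, X j = inr false & c j = (c i).+1].
    case=> Xi Xj cij; case/negP: nodup; apply/existsP; exists i.
    by apply/existsP; exists j; rewrite ij cij Xi Xj !eqxx.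
  move: ndup (tadj i j ij); rewrite /choice_pos.
  case: (X i) => [?|[]]; case: (X j) => [?|[]] ndup tij;
    split; try (by move=> _; apply: tij; auto);
    try (have {}ndup : c j <> (c i).+1 by move=> e; exact: ndup);
    by case: (s i); case: (s j); lia.
apply: (coldet_ge0_dedup (m := fun j => choice_pos (c j) (X j) (s j))).
- by move=> i j /step [].
- move=> i j /step[_ tij] pij k.
  congr (bidiag_col g _ _ k); [exact: tij|exact: pij].
- exact: coldet_bidiag_ge0.
Qed.

End PositiveChoices.

(** * Products of infinite banded matrices *)

Lemma infmx_mul_supp (A : comNzRingType) (M N : infmx A) (ks : seq nat) i j :
    uniq ks -> (forall k, k \notin ks -> N k j = 0) ->
  infmx_mul M N i j = \sum_(k <- ks) M i k * N k j.
Proof.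
move=> ks_uniq N0; rewrite /infmx_mul (fsbigE ks) //.
  by apply: eq_bigl => k; rewrite in_setT.
by move=> k _ /N0 ->; rewrite mulr0.
Qed.

Lemma infmx_mul_diag (A : comNzRingType) (M : infmx A) (e : nat -> A) i j :
  infmx_mul M (infmx_diag e) i j = M i j * e j.
Proof.
rewrite (@infmx_mul_supp _ _ _ [:: j]) // => [|k].
  by rewrite big_seq1 /infmx_diag eqxx.
by rewrite inE /infmx_diag => /negPf ->.
Qed.

Lemma infmx_mul_upper (A : comNzRingType) (M : infmx A) (d c : nat -> A) i j :
  infmx_mul M (upper_bidiag d c) i j =
  M i j * d j + (if j is j'.+1 then M i j' * c j' else 0).
Proof.
case: j => [|j].
  rewrite (@infmx_mul_supp _ _ _ [:: 0%N]) // => [|k].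
    by rewrite big_seq1 /upper_bidiag eqxx addr0.
  by rewrite inE /upper_bidiag => /negPf ->.
rewrite (@infmx_mul_supp _ _ _ [:: j.+1; j]) ?big_cons ?big_nil ?addr0 //.
- by rewrite /upper_bidiag eqxx ltn_eqF // eqxx.
- by rewrite /= inE gtn_eqF.
move=> k; rewrite !inE negb_or /upper_bidiag => /andP[/negPf -> /negPf kj].
by rewrite eqSS eq_sym kj.
Qed.

Lemma infmx_mul_lower (A : comNzRingType) (M : infmx A) (a b : nat -> A) i j :
  infmx_mul M (lower_bidiag a b) i j = M i j * a j + M i j.+1 * b j.
Proof.
rewrite (@infmx_mul_supp _ _ _ [:: j; j.+1]) ?big_cons ?big_nil ?addr0 //.
- by rewrite /lower_bidiag !eqxx gtn_eqF.
- by rewrite /= inE ltn_eqF.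
move=> k; rewrite !inE negb_or /lower_bidiag => /andP[/negPf -> /negPf ->].
by [].
Qed.

Lemma eq_infmx_mulr (A : comNzRingType) (M N N' : infmx A) :
  N =2 N' -> infmx_mul M N =2 infmx_mul M N'.
Proof.
by move=> eN i j; rewrite /infmx_mul; apply: eq_fsbigr => k _; rewrite eN.
Qed.

Lemma scaled_lower_bidiag (A : comNzRingType) (z x : A) (a b : nat -> A) :
  (z *: infmx_id A + x *: lower_bidiag a b)%IM =2
  lower_bidiag (fun m => z + x * a m) (fun m => x * b m).
Proof.
move=> i j; rewrite /infmx_add /infmx_scale /infmx_id /infmx_diag /lower_bidiag.
have [//|_] := eqVneq i j; first by rewrite mulr1.
by rewrite mulr0 add0r; case: eqP; rewrite ?mulr0.
Qed.

(** * Commuting factors and the columns of P *)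

Section CommutingBidiagonals.
Variables (A : comNzRingType) (z x : bool -> A) (a b : nat -> A).

Definition bidiag_coef (t : bool) (m : nat) (s : bool) : A :=
  if s then x t * b m else z t + x t * a m.

Definition bidiag_mx (t : bool) : infmx A :=
  (z t *: infmx_id A + x t *: lower_bidiag a b)%IM.

Lemma bidiag_mxE t i m : bidiag_mx t i m = bidiag_col bidiag_coef t m i.
Proof.
rewrite /bidiag_mx scaled_lower_bidiag /bidiag_col big_bool /= /unit_col.
rewrite addn0 addn1 /lower_bidiag.
have [->|_] := eqVneq i m; first by rewrite ltn_eqF // mulr0 mulr1 add0r.
by rewrite mulr0 addr0; case: eqP; rewrite ?mulr0 ?mulr1.
Qed.

Lemma bidiag_mx_mul t k i : infmx_mul (bidiag_mx true) (bidiag_mx false) i k =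
  \sum_(s : bool) bidiag_coef (~~ t) k s * bidiag_col bidiag_coef t (k + s) i.
Proof.
rewrite (eq_infmx_mulr _ (scaled_lower_bidiag _ _ _ _)).
rewrite infmx_mul_lower !bidiag_mxE !big_bool /= addn0 addn1.
(* For [t = true] this is the product itself; [t = false] is commutation, checked entrywise. *)
case: t => /=; first by rewrite /bidiag_coef; ring.
rewrite /bidiag_col !big_bool /= /unit_col !addn0 !addn1 /bidiag_coef.
ring.
Qed.

(** Column [j] of U has [c j.-1] in row [j - 1]; at [j = 0] this weight multiplies the zero
    column. *)
Definition choice_weight (d c e f : nat -> A) (j : nat) (X : bool + bool) : A :=
  match X with
  | inl t => if t then e j else f j
  | inr true => d j
  | inr false => c j.-1
  end.

Lemma column_choices (d c e f : nat -> A) i j :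
  (bidiag_mx true * bidiag_mx false * upper_bidiag d c +
   bidiag_mx true * infmx_diag e + bidiag_mx false * infmx_diag f)%IM i j =
  \sum_X choice_weight d c e f j X *
    choice_col bidiag_coef
      (fun k l => infmx_mul (bidiag_mx true) (bidiag_mx false) l k) j X i.
Proof.
rewrite /infmx_add infmx_mul_upper !infmx_mul_diag big_sumType !big_bool.
rewrite !bidiag_mxE /=.
case: j => [|k] /=; ring.
Qed.

End CommutingBidiagonals.

Lemma bidiag_coef_ge0 (R : numDomainType) (z x : bool -> polyvar R)
    (a b : nat -> polyvar R) t m s :
    (forall t, coef_ge0 (z t)) -> (forall t, coef_ge0 (x t)) ->
    (forall m, coef_ge0 (a m)) -> (forall m, coef_ge0 (b m)) ->
  coef_ge0 (bidiag_coef z x a b t m s).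
Proof.
move=> z0 x0 a0 b0; rewrite /bidiag_coef.
case: s; first exact: coef_ge0M (x0 t) (b0 m).
exact: coef_ge0D (z0 t) (coef_ge0M (x0 t) (a0 m)).
Qed.

Theorem theoremC1 (R : numDomainType) :
  let alpha := indet R valpha in
  let beta := indet R vbeta in
  let x := indet R vx in
  let y := indet R vy in
  let I := infmx_id (polyvar R) in
  let L := lower_bidiag (fun n => indet R (va n)) (fun n => indet R (vb n)) in
  let U := upper_bidiag (fun n => indet R (vd n)) (fun n => indet R (vc n)) in
  let D1 := infmx_diag (fun n => indet R (ve n)) in
  let D2 := infmx_diag (fun n => indet R (vf n)) in
  let L1 := (alpha *: I + x *: L)%IM in
  let L2 := (beta *: I + y *: L)%IM in
  let P := (L1 * L2 * U + L1 * D1 + L2 * D2)%IM in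
  coef_totally_positive P.
Proof.
move=> alpha beta x y I L U D1 D2 L1 L2 P n r c r_mono c_mono.
pose z1 t := if t then alpha else beta; pose x1 t := if t then x else y.
pose g := bidiag_coef z1 x1 (fun n => indet R (va n)) (fun n => indet R (vb n)).
have g_ge0 t m s : coef_ge0 (g t m s).
  by apply: bidiag_coef_ge0 => [[]|[]|k|k]; exact: coef_ge0_indet.
rewrite /minor -/(coldet r (fun j i => P i (c j))).
rewrite (eq_coldet _ (fun j i => column_choices z1 x1 _ _ _ _ _ _ i (c j))).
apply: coldet_sum_ge0 => [j X|phi].
  by case: X => -[]; exact: coef_ge0_indet.
exact: coldet_choice_ge0 (bidiag_mx_mul _ _ _ _) _.
Qed.
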